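(* Let $T$ be a simplicial tree with countable vertex set which is not isomorphic to a bi-infinite line, let $k\ge 1$ be an integer, and suppose that $G\le \mathrm{Aut}(T)$ is geometrically dense and satisfies Property $P_k$. Then the group $G^{+_k}$ is either simple or trivial.
   Context: $T$ carries the standard path metric $d$, with adjacent vertices at distance $1$. A ray is an isometric embedding of $\mathbb{R}_{\ge 0}$ in $T$; two rays are equivalent if they eventually coincide up to a shift of parameter, and the set of equivalence classes (ends) is the boundary $\partial T$. A group $G\le\mathrm{Aut}(T)$ is geometrically dense if it does not fix any end of $T$ and does not stabilize (as a set) any proper (non-empty) subtree of $T$. For a subgraph $Y$, $\mathrm{Fix}_G(Y)$ is the subgroup of those $g\in G$ with $gy=y$ for every vertex $y$ of $Y$. For a finite, infinite or bi-infinite reduced (non-backtracking) path $C$ in $T$ and an integer $m\ge 0$, let $C^m$ be the $m$-neighborhood of $C$, i.e. the subtree spanned by all vertices at distance at most $m$ from $C$. For an edge $e$, $e^m$ denotes the $m$-neighborhood of $e$. Let $\pi_C:T\to C$ be the nearest point projection and, for each vertex $x$ of $C$, let $T_x:=\pi_C^{-1}(x)=\{z\in T\mid d(x,z)\le d(y,z)\text{ for all } y\in C\}$ (on vertices). The group $\mathrm{Fix}_G(C^{k-1})$ acts on each $T_x$; let $F_x$ be the permutation group obtained by restricting $\mathrm{Fix}_G(C^{k-1})$ to $T_x$. The restrictions give an injective homomorphism $\Phi:\mathrm{Fix}_G(C^{k-1})\to\prod_{x\in C}F_x$. The group $G$ satisfies Property $P_k$ if for every finite or (bi-)infinite path $C$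 in $T$ the map $\Phi$ is an isomorphism. $G^{+_k}:=\langle \mathrm{Fix}_G(e^{k-1})\mid e \text{ an edge of } T\rangle$. *)

(* Defs.v *)
From HB Require Import structures.
From mathcomp Require Import all_boot all_order all_algebra.
From mathcomp Require Import boolp classical_sets functions.

Set Implicit Arguments.
Unset Strict Implicit.
Unset Printing Implicit Defensive.

Import Order.TTheory GRing.Theory Num.Theory.

Local Open Scope classical_set_scope.
Local Open Scope group_scope.

Section Groups.
Variable gT : groupType.
Implicit Types H N S : set gT.

Definition is_subgroup H : Prop := group_closed (mem H).

Definition generated S : set gT := smallest is_subgroup S.

Definition normal_in N H : Prop :=
  [/\ is_subgroup N, N `<=` H & forall n h, N n -> H h -> N (n ^ h)].

Definition is_trivial H : Prop := H = [set 1].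

Definition is_simple H : Prop :=
  ~ is_trivial H /\ forall N, normal_in N H -> is_trivial N \/ N = H.

End Groups.

Record tree (V : countType) := Tree {
  adj : rel V;
  adj_sym : symmetric adj;
  adj_irr : irreflexive adj;
  tree_inh : exists x : V, True;
  tree_conn : forall x y, exists p, path adj x p /\ last x p = y;
  tree_acyclic : forall c, ucycle adj c -> (size c <= 2)%N
}.

Section Distance.
Variables (V : countType) (T : tree V).

Definition has_walk x y n : Prop :=
  exists p, [/\ path (adj T) x p, last x p = y & size p = n].

Lemma has_walk_ex x y : exists n, `[< has_walk x y n >].
Proof. by have [p [xp py]] := tree_conn T x y; exists (size p); apply/asboolP; exists p. Qed.

Definition dist x y : nat := ex_minn (has_walk_ex x y).

End Distance.

(* The inverse map carries no extra information: by [autP] an automorphism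
   is determined by its action on vertices. *)
Record aut (V : countType) (T : tree V) := Aut {
  aut_fun :> V -> V;
  aut_inv : V -> V;
  aut_funK : cancel aut_fun aut_inv;
  aut_invK : cancel aut_inv aut_fun;
  aut_adj : {mono aut_fun : x y / adj T x y}
}.

Section AutGroup.
Variables (V : countType) (T : tree V).
Implicit Types g h : aut T.

Lemma autP g h : g =1 h -> g = h.
Proof.
case: g => f f' fK f'K fA; case: h => k k' kK k'K kA /= fk.
have Ef : f = k by apply: funext.
subst k; have Ef' : f' = k' by apply: funext => x; rewrite -[in LHS](k'K x) fK.
by subst k'; congr Aut; apply: Prop_irrelevance.
Qed.

Definition aut1 : aut T :=
  @Aut V T id id (fun=> erefl) (fun=> erefl) (fun _ _ => erefl).

Lemma autV_adj g : {mono aut_inv g : x y / adj T x y}.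
Proof. by move=> x y; rewrite -(aut_adj g) !aut_invK. Qed.

Definition autV g : aut T := Aut (aut_invK g) (aut_funK g) (@autV_adj g).

Lemma autM_adj g h : {mono g \o h : x y / adj T x y}.
Proof. by move=> x y; rewrite /= !aut_adj. Qed.

Definition autM g h : aut T :=
  Aut (can_comp (aut_funK g) (aut_funK h))
      (can_comp (aut_invK h) (aut_invK g)) (@autM_adj g h).

HB.instance Definition _ := gen_eqMixin (aut T).
HB.instance Definition _ := gen_choiceMixin (aut T).

Lemma autMA : associative autM. Proof. by move=> f g h; apply: autP. Qed.
Lemma aut1M : left_id aut1 autM. Proof. by move=> g; apply: autP. Qed.
Lemma autM1 : right_id aut1 autM. Proof. by move=> g; apply: autP. Qed.
Lemma autVM : left_inverse aut1 autV autM.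
Proof. by move=> g; apply: autP => x /=; rewrite aut_funK. Qed.
Lemma autMV : right_inverse aut1 autV autM.
Proof. by move=> g; apply: autP => x /=; rewrite aut_invK. Qed.

HB.instance Definition _ := isGroup.Build (aut T) autMA aut1M autM1 autVM autMV.

End AutGroup.

Section TreeGeometry.
Variables (V : countType) (T : tree V).
Implicit Types (x y z : V) (C S Y : set V) (m k : nat).

Definition is_line : Prop :=
  exists f : int -> V,
    bijective f /\ forall i j, adj T (f i) (f j) = (`|i - j|%R == 1%R).

(* Rays are given by their vertices: a metric ray in the geometric realization
   coincides, after deleting its initial segment before the first vertex, with
   exactly one such vertex sequence. *)
Definition is_ray (r : nat -> V) : Prop :=
  forall i j : nat, dist T (r i) (r j) = `|i - j|%N.

Definition ray_equiv (r s : nat -> V) : Prop :=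
  exists a b, forall i, r (a + i)%N = s (b + i)%N.

Definition boundary : set (set (nat -> V)) :=
  [set [set s | is_ray s /\ ray_equiv r s] | r in is_ray].

Definition fixes_end (G : set (aut T)) (xi : set (nat -> V)) : Prop :=
  forall g, G g -> (fun r : nat -> V => g \o r) @` xi = xi.

(* Subgraphs are given by their vertices: in a tree every connected subgraph is
   induced. *)
Definition is_subtree S : Prop :=
  S !=set0 /\
  forall x y, S x -> S y ->
    exists p, [/\ path (adj T) x p, last x p = y & forall z, z \in p -> S z].

Definition stabilizes (G : set (aut T)) S : Prop :=
  forall g, G g -> g @` S = S.

Definition geometrically_dense (G : set (aut T)) : Prop :=
  (forall xi, boundary xi -> ~ fixes_end G xi) /\
  (forall S, is_subtree S -> S <> setT -> ~ stabilizes G S).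

Definition Fix (G : set (aut T)) Y : set (aut T) :=
  [set g | G g /\ forall y, Y y -> g y = y].

(* A path is parametrized by a nonempty interval of the integers: bounded
   intervals give the finite paths (including single vertices), half-lines the
   infinite ones and the full set the bi-infinite ones. *)
Definition is_reduced_path C : Prop :=
  exists (I : set int) (c : int -> V),
  [/\ I !=set0 /\ (forall i j l : int, I i -> I j -> (i <= l <= j)%R -> I l),
      forall i, I i -> I (i + 1)%R -> adj T (c i) (c (i + 1)%R),
      forall i, I i -> I (i + 2)%R -> c i <> c (i + 2)%R
    & C = c @` I].

Definition nbhd C m : set V := [set y | exists2 x, C x & (dist T x y <= m)%N].

Definition branch C x : set V :=
  [set z | forall y, C y -> (dist T x z <= dist T y z)%N].

(* A permutation of the branch at [x] is encoded as a map on all vertices that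
   is the identity outside the branch, so that composition is the group law. *)
Definition restr C x (g : aut T) : V -> V := patch id (branch C x) g.

Definition branch_group (G : set (aut T)) k C x : set (V -> V) :=
  restr C x @` Fix G (nbhd C k.-1).

Definition branch_product (G : set (aut T)) k C : set (C -> V -> V) :=
  [set f | forall x : C, branch_group G k C (\val x) (f x)].
Arguments branch_product G k C f : clear implicits.

Definition Phi C (g : aut T) : C -> V -> V :=
  fun x : C => restr C (\val x) g.
Arguments Phi C g x z : clear implicits.

Definition property_P k (G : set (aut T)) : Prop :=
  forall C, is_reduced_path C ->
    (forall g h, Fix G (nbhd C k.-1) g -> Fix G (nbhd C k.-1) h ->
       Phi C (g * h) = fun x : C => Phi C g x \o Phi C h x) /\
    set_bij (Fix G (nbhd C k.-1)) (branch_product G k C) (Phi C).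

Definition G_plus k (G : set (aut T)) : set (aut T) :=
  generated [set g | exists x y,
    adj T x y /\ Fix G (nbhd [set x; y] k.-1) g].

End TreeGeometry.

Arguments branch_product {V T} G k C f.
Arguments Phi {V T} C g x z.

(* Main.v *)
Require Import Defs.
From mathcomp Require Import all_boot all_order all_algebra.
From mathcomp Require Import boolp classical_sets functions.
From mathcomp Require Import zify.

(** Following Tits, every nontrivial normal subgroup [N] of [H = G_plus k G] is
    shown to contain the generators of [H].

    The geometry is expressed through half-trees: [beyond T x y] is the half-tree
    on the side of [y] of the edge between [x] and [y], and a path can enter it
    only through that edge ([beyond_cross]). Density of a group is then used in
    the form: any half-tree can be carried into any other one
    ([transitive_on_half_trees]). For a subgroup it is enough that every half-tree can be
    carried off itself ([flips], [flips_transitive]).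

    A geometrically dense group has this property ([dense_flips]): if all the
    translates of a half-tree met each other, then from each vertex one could
    move towards all the translates that avoid it at once, and iterating this
    move would lead to an invariant end. The property passes from a group to
    the nontrivial subgroups that it normalizes
    ([normalized_transitive_on_half_trees]): a nontrivial automorphism carries some
    half-tree off itself ([nontrivial_flip]), and conjugating it gives an element
    that does so for any prescribed half-tree. It therefore descends from [G] to
    [H] and from [H] to [N].

    Consequently any half-tree contains the axis of a hyperbolic element of [N]
    ([axis_in_half]). Let [g] fix the [(k-1)]-neighbourhood of the edge
    between [x] and [y] and all of the half-tree beyond [y], and let [h] in [N]
    have its axis in that half-tree. The part of the tree moved by [g] hangs at a
    single vertex [w] of the axis, and Property [P_k] along the axis provides an
    [f] that acts as [h^n g h^-n] on the branch at [h^n w] for every [n >= 0] and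
    trivially on the other branches. Conjugating [f] by [h] deletes the factor
    [n = 0], so [g = f (h f^-1 h^-1)], which lies in [N] ([commutator_trick]).
    By Property [P_k] along a single edge, each generator of [H] is a product of
    two such elements [g], one for each side of the edge ([Fix_edge_split]). *)

Set Implicit Arguments.
Unset Strict Implicit.
Unset Printing Implicit Defensive.

Import Order.TTheory GRing.Theory Num.Theory.
Local Open Scope classical_set_scope.

(** * Subgroups *)

Section Subgroups.
Variables (gT : groupType) (H : set gT).
Hypothesis Hgrp : is_subgroup H.
Implicit Types g h : gT.

Lemma subgroup1 : H 1%g.
Proof. by case: Hgrp => /set_mem. Qed.

Lemma subgroupM g h : H g -> H h -> H (g * h)%g.
Proof. by move=> /mem_set Hg /mem_set Hh; apply/set_mem/(group_closedM Hgrp). Qed.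

Lemma subgroupV g : H g -> H (g^-1)%g.
Proof. by move=> /mem_set Hg; apply/set_mem/(group_closedV Hgrp). Qed.

End Subgroups.

Section GeneratedSubgroups.
Variable gT : groupType.
Implicit Types (H S : set gT) (g h : gT).

Lemma is_subgroupI H : H 1%g -> (forall g h, H g -> H h -> H (g * h^-1)%g) ->
  is_subgroup H.
Proof.
move=> H1 HM; split; first exact/mem_set.
by move=> g h /set_mem Hg /set_mem Hh; apply/mem_set/HM.
Qed.

Lemma generated_subgroup S : is_subgroup (generated S).
Proof.
apply: is_subgroupI => [|g h Hg Hh] M [Mgrp SM]; first exact: subgroup1.
by apply: subgroupM; [|apply: Hg|apply: subgroupV => //; apply: Hh].
Qed.

Lemma generated_conj S (d : gT) : (forall g, S g -> S (g ^ d)%g) ->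
  forall g, generated S g -> generated S (g ^ d)%g.
Proof.
move=> Sd g; apply: (@smallest_sub _ _ _ [set g | generated S (g ^ d)%g]).
  have Hgrp := generated_subgroup S.
  apply: is_subgroupI => [|a b Ha Hb] /=; first by rewrite conj1g; apply: (subgroup1 Hgrp).
  by rewrite conjMg conjVg; apply: (subgroupM Hgrp) => //; apply: (subgroupV Hgrp).
by move=> a Sa; apply: (@sub_gen_smallest _ _ S); apply: Sd.
Qed.

Lemma exists_nontrivial H : is_subgroup H -> ~ is_trivial H ->
  exists2 h, H h & h <> 1%g.
Proof.
move=> Hgrp nH; apply: contrapT => no; apply: nH; apply/seteqP; split=> h /=.
  by move=> Hh; apply: contrapT => h1; apply: no; exists h.
by move=> ->; apply: subgroup1.
Qed.

End GeneratedSubgroups.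

(** * Distances and simple paths in a tree *)

Section Distance.
Variables (V : countType) (T : tree V).
Implicit Types (x y z a b c o v w : V) (p q : seq V) (g h : aut T).

Local Notation adj := (adj T).
Local Notation dist := (dist T).

Lemma adjC x y : adj x y = adj y x.
Proof. exact: adj_sym. Qed.

Lemma adj_neq x y : adj x y -> x != y.
Proof. by apply: contraTneq => ->; rewrite adj_irr. Qed.

Lemma dist_walk x y :
  exists p, [/\ path adj x p, last x p = y & size p = dist x y].
Proof. by rewrite /Defs.dist; case: ex_minnP => n /asboolP. Qed.

Lemma dist_min x p : path adj x p -> (dist x (last x p) <= size p)%N.
Proof.
move=> xp; rewrite /Defs.dist; case: ex_minnP => n _ -> //.
by apply/asboolP; exists p.
Qed.

Lemma dist_refl x : dist x x = 0%N.
Proof. by have := @dist_min x [::] isT; rewrite leqn0 => /eqP. Qed.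

Lemma dist_eq0 x y : dist x y = 0%N -> x = y.
Proof. by move=> d0; have [[|? ?] [_ /= ? ]] := dist_walk x y; rewrite ?d0. Qed.

Lemma distC x y : dist x y = dist y x.
Proof.
suff le a b : (dist a b <= dist b a)%N by apply/eqP; rewrite eqn_leq !le.
have [p [bp pa <-]] := dist_walk b a.
have := @dist_min a (rev (belast b p)).
rewrite -{1}pa rev_path (eq_path (fun u v => adj_sym T v u)) size_rev size_belast.
move=> /(_ bp); congr (dist _ _ <= _)%N.
by case: p pa {bp} => [|u p] //= _; rewrite rev_cons last_rcons.
Qed.

Lemma dist_triangle y x z : (dist x z <= dist x y + dist y z)%N.
Proof.
have [p [xp py <-]] := dist_walk x y; have [q [yq qz <-]] := dist_walk y z.
by rewrite -size_cat -qz -py -last_cat dist_min // cat_path xp py.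
Qed.

Lemma dist_adj x y z : adj x y -> (dist x z <= (dist y z).+1)%N.
Proof.
move=> xy; have [p [yp <- <-]] := dist_walk y z.
by apply: (@dist_min x (y :: p)); rewrite /= xy.
Qed.

Lemma geodesic_step x y : x != y ->
  exists2 x', adj x x' & dist x y = (dist x' y).+1.
Proof.
have [[|x' p] [/= xp px sz]] := dist_walk x y; first by rewrite px eqxx.
case/andP: xp => xx' xp _; exists x' => //; apply/eqP.
by rewrite eqn_leq dist_adj // -sz -px ltnS dist_min.
Qed.

Lemma adj_connected (Q : V -> Prop) x :
  Q x -> (forall a b, adj a b -> Q a -> Q b) -> forall y, Q y.
Proof.
move=> Qx step y; have [p [xp <-]] := tree_conn T x y.
by elim: p x Qx xp => //= z p IH x Qx /andP[xz]; apply/IH/(step _ _ xz).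
Qed.

(** Where two simple paths from [x] to the same vertex first differ, by moving
    to [a] and to [b], their remainders join [a] to [b] without passing [x], and
    going back to [x] closes up a cycle. *)
Lemma simple_path_uniq x p q : path adj x p -> path adj x q ->
  uniq (x :: p) -> uniq (x :: q) -> last x p = last x q -> p = q.
Proof.
elim: p x q => [|a p IH] x [|b q] //=.
- by move=> _ _ _ + xE; rewrite {1}xE mem_last.
- by move=> _ _ + _ xE; rewrite -{1}xE mem_last.
move=> /andP[xa ap] /andP[xb bq] /andP[xNp Up] /andP[xNq Uq] E.
have [ab|ab] := eqVneq a b.
  by move: ab bq Uq E => <- aq Uq E; congr (_ :: _); apply: (IH a).
(* Follow [p] to the common end and come back along [q]. *)
have walk : path adj a (p ++ rev (belast b q)).
  rewrite cat_path ap E rev_path (eq_path (e' := adj)) // => u v; exact: adj_sym.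
have lastE : last a (p ++ rev (belast b q)) = b.
  rewrite last_cat E; case: (q) => [|u s] //=.
  by rewrite rev_cons last_rcons.
have xNwalk : x \notin a :: p ++ rev (belast b q).
  rewrite -cat_cons mem_cat mem_rev negb_or xNp /=.
  by apply: contra xNq => /mem_belast.
move: lastE xNwalk; case/shortenP: walk => s as_ Us sub sE xNwalk.
have: ucycle adj (x :: a :: s).
  rewrite /ucycle /= rcons_path xa as_ sE adjC xb /=.
  rewrite [_ && uniq s]Us andbT; apply: contra xNwalk.
  by rewrite !inE => /orP[->//|/sub ->]; rewrite orbT.
by move=> /tree_acyclic; case: s sE {as_ Us sub} => //= /eqP; rewrite (negPf ab).
Qed.

Lemma geodesic_simple x y : exists p,
  [/\ path adj x p, last x p = y, uniq (x :: p) & size p = dist x y].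
Proof.
have [p [xp py sz]] := dist_walk x y.
case/shortenP: xp py sz => s xs Us sub sE sz; exists s; split => //.
apply/eqP; rewrite eqn_leq -{2}sE dist_min // andbT -sz.
by apply: uniq_leq_size => //; case/andP: Us.
Qed.

Lemma geodesic_dist x p z : path adj x p -> z \in p ->
  (dist z (last x p) < size p)%N.
Proof.
move=> + zp; case/splitPr: zp => p1 p2; rewrite cat_path => /and3P[_ _ zp2].
by rewrite last_cat /= size_cat /= addnS ltnS (leq_trans (dist_min zp2)) // leq_addl.
Qed.

(** Otherwise the geodesic from [x] to [z] and the one through [y] would be two
    simple paths of different lengths. *)
Lemma dist_adj_neq x y z : adj x y -> dist x z != dist y z.
Proof.
move=> xy; apply/eqP => E.
have [p [xp pz Up szp]] := geodesic_simple x z.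
have [q [yq qz Uq szq]] := geodesic_simple y z.
suff: p = y :: q by move=> /(congr1 size) /=; rewrite szp szq E; lia.
apply: (@simple_path_uniq x) => //=; rewrite ?xy ?pz //.
rewrite -[X in _ && X]/(uniq (y :: q)) Uq andbT inE (negPf (adj_neq xy)) /=.
by apply/negP => /(geodesic_dist yq); rewrite qz szq -E ltnn.
Qed.

(** A tree is bipartite, so the distance to [z] changes along every edge. *)
Lemma dist_adjE x y z : adj x y ->
  dist x z = (dist y z).+1 \/ dist y z = (dist x z).+1.
Proof.
move=> xy; have yx : adj y x by rewrite adjC.
by have := dist_adj_neq z xy; have := dist_adj z xy; have := dist_adj z yx; lia.
Qed.

(** Both neighbours start a simple path from [z] to [o], and there is only one. *)
Lemma closer_uniq o z a b : adj z a -> adj z b ->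
  (dist a o < dist z o)%N -> (dist b o < dist z o)%N -> a = b.
Proof.
move=> za zb la lb.
have [p [ap po Up szp]] := geodesic_simple a o.
have [q [bq qo Uq szq]] := geodesic_simple b o.
suff: a :: p = b :: q by case.
have simple c s : adj z c -> (dist c o < dist z o)%N -> path adj c s ->
    last c s = o -> uniq (c :: s) -> size s = dist c o -> uniq (z :: c :: s).
  move=> zc lc cs so Us sz; rewrite cons_uniq Us andbT.
  rewrite inE (negPf (adj_neq zc)) /=; apply/negP.
  by move=> /(geodesic_dist cs); rewrite so sz; lia.
apply: (@simple_path_uniq z); rewrite ?simple //= ?za ?zb //.
by rewrite po qo.
Qed.

Lemma dist_aut g x y : dist (g x) (g y) = dist x y.
Proof.
suff le h a b : (dist (h a) (h b) <= dist a b)%N.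
  by apply/eqP; rewrite eqn_leq le -{1}(aut_funK g x) -{1}(aut_funK g y) (le (autV g)).
have [p [ap <- <-]] := dist_walk a b.
rewrite -(size_map h) -last_map dist_min // path_map.
by rewrite (eq_path (e' := adj)) // => u v; apply: aut_adj.
Qed.

End Distance.

(** * Half-trees *)

Section HalfTrees.
Variables (V : countType) (T : tree V).
Implicit Types (x y z a b c o v w : V) (g h : aut T) (S : set V).

Local Notation adj := (adj T).
Local Notation dist := (dist T).

(** For adjacent [x] and [y], the half-tree containing [y] that is left after
    removing the edge; it is boolean so that complements need no classical
    reasoning. *)
Definition beyond x y z := (dist y z < dist x z)%N.

Lemma beyondE x y z : beyond x y z = (dist y z < dist x z)%N.
Proof. by []. Qed.

Lemma beyond_aut g x y z : beyond (g x) (g y) (g z) = beyond x y z.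
Proof. by rewrite /beyond !dist_aut. Qed.

Lemma beyond_tip x y : adj x y -> beyond x y y.
Proof. by move=> /(dist_adjE y); rewrite /beyond dist_refl; lia. Qed.

Lemma beyond_base x y : beyond x y x = false.
Proof. by rewrite /beyond dist_refl. Qed.

Lemma beyondC x y z : adj x y -> beyond y x z = ~~ beyond x y z.
Proof. by move=> /(dist_adjE z); rewrite /beyond; lia. Qed.

Lemma beyond_disj x y y' z :
  adj x y -> adj x y' -> y != y' -> beyond x y z -> ~~ beyond x y' z.
Proof.
by move=> xy xy' + h; apply: contraNN => h'; rewrite (closer_uniq xy xy' h h').
Qed.

Lemma beyond_next x y z w :
  adj x y -> adj y z -> x != z -> beyond y z w -> beyond x y w.
Proof.
rewrite adjC => yx yz xz h; rewrite beyondC //.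
by apply: beyond_disj h; rewrite // eq_sym.
Qed.

Lemma beyond_toward x z : x != z -> exists2 y, adj x y & beyond x y z.
Proof. by move=> /(geodesic_step T) [y xy E]; exists y; rewrite // /beyond E. Qed.

(** If [a -> b] is a second edge leading across, both distances to [x] and to
    [y] drop when moving from [a] towards [x] unless [a = x], whereas the only
    neighbour of [a] that is closer to [y] is [b], which is farther from [x]. *)
Lemma beyond_cross x y a b : adj x y -> adj a b ->
  ~~ beyond x y a -> beyond x y b -> a = x /\ b = y.
Proof.
rewrite /beyond => xy ab Na hb.
have yx : adj y x by rewrite adjC.
have ba : adj b a by rewrite adjC.
have ax := dist_adj x ab; have ay := dist_adj y ab.
have bx := dist_adj x ba; have by_ := dist_adj y ba.
have xa := dist_adjE a xy; have xb := dist_adjE b xy.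
rewrite !(distC T x) !(distC T y) in Na hb xa xb.
have [E|/(geodesic_step T)[c ac Ec]] := eqVneq a x.
  split=> //; apply: (@dist_eq0 _ T); move: xb hb bx; rewrite E dist_refl; lia.
have cy := dist_adj c xy; rewrite !(distC T _ c) in cy.
have yc := dist_adj c yx; rewrite !(distC T _ c) in yc.
(* [c] is the next vertex on the way from [a] to [x]. *)
have cb : c = b by apply: (@closer_uniq _ _ y a) => //; lia.
by move: Ec; rewrite cb; lia.
Qed.

Lemma beyond_step x y a b a' : adj x y -> beyond x y a -> beyond x y b ->
  adj a a' -> dist a b = (dist a' b).+1 -> beyond x y a'.
Proof.
move=> xy ha hb aa' E; apply: contraTT isT => Na'.
have [] := beyond_cross xy _ Na' ha; first by rewrite adjC.
by move=> a'x ay; move: hb E; rewrite /beyond a'x ay; lia.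
Qed.

(** A half-tree that starts inside another one and misses its base point stays
    inside, since the only way out leads through the base point. *)
Lemma beyond_sub x y a b z : adj x y -> adj a b -> beyond x y b -> ~~ beyond a b x ->
  beyond a b z -> beyond x y z.
Proof.
move=> xy ab hb Nx; move Dn: (dist z b) => n.
elim: n z Dn => [|n IH] z Dn hz; first by rewrite (dist_eq0 Dn).
have [E|/(geodesic_step T)[z' zz' Ez]] := eqVneq z b; first by rewrite E.
have hz' := beyond_step ab hz (beyond_tip ab) zz' Ez.
have {IH} h' : beyond x y z' by apply: IH => //; lia.
apply: contraTT h' => Nz; apply/negP => h'.
by have [E _] := beyond_cross xy zz' Nz h'; move: hz; rewrite E (negPf Nx).
Qed.

(** Half-trees that point away from each other are disjoint: the second one lies
    in the complement of the first, which is a half-tree as well. *)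
Lemma beyond_apart x y a b z : adj x y -> adj a b -> x != a ->
  ~~ beyond x y a -> ~~ beyond a b x -> beyond a b z -> ~~ beyond x y z.
Proof.
move=> xy ab xa Na Nx hz; have yx : adj y x by rewrite adjC.
rewrite -beyondC //; apply: (@beyond_sub _ _ a b) => //.
  rewrite beyondC //; apply/negP => hb.
  by have [ax _] := beyond_cross xy ab Na hb; rewrite ax eqxx in xa.
apply/negP => hy; have [E _] := beyond_cross ab xy Nx hy.
by rewrite E eqxx in xa.
Qed.

(** Every path from a half-tree to its complement runs through the edge that
    separates them. *)
Lemma dist_through x y c z : adj x y -> beyond x y c -> ~~ beyond x y z ->
  dist c z = (dist c x + dist x z)%N.
Proof.
move=> xy; move Dn: (dist c z) => n.
elim: n c Dn => [|n IH] c Dn hc Nz; first by rewrite (dist_eq0 Dn) (negPf Nz) in hc.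
have cz : c != z by apply: contraNneq Nz => <-.
have [c' cc' E] := geodesic_step T cz.
have := dist_triangle T x c z; have := dist_adj x cc'.
have [hc'|Nc'] := boolP (beyond x y c'); first by have := IH c'; rewrite hc' Nz; lia.
have [] := beyond_cross xy _ Nc' hc; first by rewrite adjC.
by move=> <- _; rewrite dist_refl; lia.
Qed.

(** Reduces connectedness to a single step of a geodesic, which suits half-trees
    and fixed-point sets; both are closed under such steps. *)
Lemma geodesically_closed_subtree S : S !=set0 ->
  (forall a b a', S a -> S b -> adj a a' -> dist a b = (dist a' b).+1 -> S a') ->
  is_subtree T S.
Proof.
move=> S0 clos; split=> // x y + Sy; move Dn: (dist x y) => n.
elim: n x Dn => [|n IH] x Dn Sx; first by exists [::]; rewrite (dist_eq0 Dn).
have [E|/(geodesic_step T)[x' xx' E]] := eqVneq x y.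
  by exists [::]; split.
have Sx' := clos _ _ _ Sx Sy xx' E.
have [|p [xp py Sp]] := IH x' _ Sx'; first by lia.
exists (x' :: p); split=> //=; first by rewrite xx'.
by move=> z; rewrite inE => /predU1P[->|/Sp].
Qed.

Section NonBacktracking.
Variable c : nat -> V.
Hypothesis c_adj : forall i, adj (c i) (c i.+1).
Hypothesis c_red : forall i, c i != c i.+2.

(** The half-trees ahead of a path without backtracking decrease, so that it
    never returns and is a geodesic. *)
Lemma beyond_nested i n z :
  beyond (c (i + n)) (c (i + n).+1) z -> beyond (c i) (c i.+1) z.
Proof.
elim: n => [|n IH]; first by rewrite addn0.
by rewrite addnS => /beyond_next h; apply/IH/h.
Qed.

Lemma nonbacktracking_dist i n : dist (c i) (c (i + n)) = n.
Proof.
elim: n => [|n IH]; first by rewrite addn0 dist_refl.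
have := @beyond_nested i n (c i); rewrite beyond_base addnS.
have := dist_adjE (c i) (c_adj (i + n)); rewrite /beyond.
by rewrite !(distC T _ (c i)) IH; lia.
Qed.

Lemma nonbacktracking_ray : is_ray T c.
Proof.
move=> i j; wlog le_ij : i j / (i <= j)%N.
  by move=> W; case/orP: (leq_total i j) => /W // E; rewrite distC E distnC.
by rewrite -{1}(subnKC le_ij) nonbacktracking_dist; lia.
Qed.

End NonBacktracking.

End HalfTrees.

(** * Geometrically dense groups carry every half-tree off itself *)

Section GroupActions.
Variables (V : countType) (T : tree V).
Implicit Types (x y z a b v w : V) (g h t : aut T) (D G M : set (aut T)).

Local Notation adj := (adj T).
Local Notation beyond := (beyond T).

Lemma autME g h z : (g * h)%g z = g (h z). Proof. by []. Qed.

Lemma autVK g : cancel g (g^-1)%g. Proof. exact: aut_funK. Qed.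

Lemma autKV g : cancel (g^-1)%g g. Proof. exact: aut_invK. Qed.

Lemma aut_inj g : injective g. Proof. exact: can_inj (autVK g). Qed.

Lemma invariant_stabilizes D S : is_subgroup D ->
  (forall g z, D g -> S z -> S (g z)) -> stabilizes D S.
Proof.
move=> Dgrp inv g Dg; apply/seteqP; split=> [_ [z Sz <-]|z Sz]; first exact: inv.
by exists (g^-1 z)%g; [apply: inv => //; apply: subgroupV | apply: autKV].
Qed.

Definition flips D := forall x y, adj x y ->
  exists2 t, D t & forall z, beyond x y z -> ~~ beyond x y (t z).

Definition transitive_on_half_trees D := forall x y a b, adj x y -> adj a b ->
  exists2 t, D t & forall z, beyond x y z -> beyond a b (t z).

Section InvariantEnd.
Variables (G : set (aut T)) (x y : V).
Hypotheses (Ggrp : is_subgroup G) (xy : adj x y).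
Hypothesis minimal : forall S, is_subtree T S -> S <> setT -> ~ stabilizes G S.
Hypothesis meet : forall s t, G s -> G t ->
  exists2 w, beyond (s x) (s y) w & beyond (t x) (t y) w.

Let adj_im t : adj (t x) (t y).
Proof. by rewrite aut_adj. Qed.

(** The vertices that belong to all the translates form an invariant subtree, and
    [x] is not one of them. *)
Lemma translate_avoids z : exists2 t, G t & ~~ beyond (t x) (t y) z.
Proof.
apply: contrapT => no.
pose S := [set w | forall t, G t -> beyond (t x) (t y) w].
have Sz : S z.
  by move=> t Gt; apply: contrapT => /negP ?; apply: no; exists t.
apply: (@minimal S).
- apply: geodesically_closed_subtree; first by exists z.
  by move=> a b a' Sa Sb aa' E t Gt; apply: beyond_step E => //; auto.
- move=> ST; have /(_ 1%g (subgroup1 Ggrp)) : S x by rewrite ST.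
  by rewrite beyond_base.
- apply: invariant_stabilizes => // g w Gg Sw t Gt.
  have := Sw (g^-1 * t)%g; rewrite !autME -(beyond_aut g) !autKV; apply.
  by apply: subgroupM => //; apply: subgroupV.
Qed.

(** One step from [z] towards all the translates of the half-tree that avoid [z];
    repeating it leads to the invariant end. *)
Definition points_to z n := adj z n /\
  forall t, G t -> ~~ beyond (t x) (t y) z -> forall w, beyond (t x) (t y) w -> beyond z n w.

(** All the translates avoiding [z] lie in the same direction: two of them have a
    common vertex, which cannot lie beyond two different neighbours of [z]. *)
Lemma points_to_ex z : exists n, points_to z n.
Proof.
have toward t : ~~ beyond (t x) (t y) z ->
    exists2 n, adj z n & forall w, beyond (t x) (t y) w -> beyond z n w.
  move=> Nz; have zty : z != t y.
    by apply: contraNneq Nz => ->; apply: beyond_tip.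
  have [n zn hn] := beyond_toward T zty; exists n => // w.
  exact: beyond_sub.
have [t Gt Nz] := translate_avoids z; have [n zn hn] := toward t Nz.
exists n; split=> // s Gs /toward[n' zn' hn'] w hw.
have [u hs ht] := meet Gs Gt.
by rewrite (closer_uniq zn zn' (hn _ ht) (hn' _ hs)); apply: hn'.
Qed.

Lemma points_to_uniq z n n' : points_to z n -> points_to z n' -> n = n'.
Proof.
move=> [zn hn] [zn' hn']; have [t Gt Nz] := translate_avoids z.
have ht := beyond_tip (adj_im t).
exact: closer_uniq zn zn' (hn t Gt Nz _ ht) (hn' t Gt Nz _ ht).
Qed.

Lemma points_to_aut g z n : G g -> points_to z n -> points_to (g z) (g n).
Proof.
move=> Gg [zn hn]; split; first by rewrite aut_adj.
move=> t Gt; have := hn (g^-1 * t)%g; rewrite !autME => {}hn Nz w hw.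
rewrite -[w](autKV g) beyond_aut; apply: hn.
- by apply: subgroupM => //; apply: subgroupV.
- by rewrite -(beyond_aut g) !autKV.
- by rewrite -(beyond_aut g) !autKV.
Qed.

(** Otherwise one translate would lie beyond [n] as seen from [z] and another one
    on the opposite side of the same edge, and they would not meet. *)
Lemma points_to_red z n : points_to z n -> ~ points_to n z.
Proof.
move=> [zn hn] [nz hz].
have [t Gt Nz] := translate_avoids z; have [s Gs Nn] := translate_avoids n.
have [w hs ht] := meet Gs Gt.
have := hn t Gt Nz w ht; have := hz s Gs Nn w hs.
by rewrite beyondC // => /negPf->.
Qed.

(** Hence the rays that start at neighbouring vertices merge, and all the rays
    define the same end. If [a] points to some [n] other than [b], the translate
    seen from [a] lies beyond [a] as seen from [b]. *)
Lemma points_to_adj a b : adj a b -> points_to a b \/ points_to b a.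
Proof.
move=> ab; have ba : adj b a by rewrite adjC.
have [n an] := points_to_ex a; have [<-|nb] := eqVneq n b; first by left.
right; have [m bm] := points_to_ex b; suff <- : m = a by [].
have [an' hn] := an; have [t Gt Nz] := translate_avoids a.
have ht := beyond_tip (adj_im t).
have Nb : ~~ beyond (t x) (t y) b.
  apply/negP => /(hn t Gt Nz) hb.
  by have := beyond_disj an' ab nb hb; rewrite beyond_tip.
have hm := bm.2 t Gt Nb _ ht.
have ha : beyond b a (t y).
  by rewrite beyondC //; apply: beyond_disj (hn t Gt Nz _ ht).
exact: closer_uniq bm.1 ba hm ha.
Qed.

Lemma exists_fixed_end : exists2 xi, boundary T xi & fixes_end G xi.
Proof.
have [nx nxP] := choice points_to_ex.
pose r z i := iter i nx z.
have nx_aut g z : G g -> nx (g z) = g (nx z).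
  move=> Gg; apply: points_to_uniq (nxP _) _.
  exact: points_to_aut (nxP z).
have r_aut g z i : G g -> r (g z) i = g (r z i).
  by move=> Gg; elim: i => //= i ->; apply: nx_aut.
have r_ray z : is_ray T (r z).
  apply: nonbacktracking_ray => i; first by case: (nxP (r z i)).
  apply/eqP => E; apply: (points_to_red (nxP (r z i))).
  by rewrite {2}E; apply: (nxP (nx (r z i))).
have r_add z i j : r z (i + j) = r (r z j) i by rewrite /r iterD.
have r_merge z z' : exists i j, r z i = r z' j.
  move: z'; apply: (@adj_connected _ T _ z) => [|a b ab [i [j E]]].
    by exists 0%N, 0%N.
  have [h|h] := points_to_adj ab.
    exists i.+1, j; rewrite -[i.+1]add1n r_add E -r_add addnC r_add.
    by rewrite [r a 1%N](points_to_uniq (nxP a) h).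
  exists i, j.+1; rewrite -addn1 r_add [r b 1%N](points_to_uniq (nxP b) h).
  exact: E.
have [z0 _] := tree_inh T.
pose xi := [set s | is_ray T s /\ ray_equiv (r z0) s].
have inv g s : G g -> xi s -> xi (g \o s).
  move=> Gg [sray [a [b E]]]; split=> [i j|]; first by rewrite /= dist_aut.
  have [a' [b' E']] := r_merge z0 (g z0).
  exists (a' + a)%N, (b' + b)%N => i.
  rewrite -addnA addnC r_add E' -r_add r_aut //= addnC addnCA E.
  by congr (g (s _)); rewrite addnCA addnA.
exists xi; first by exists (r z0).
move=> g Gg; apply/seteqP; split=> [_ [s xis <-]|s xis]; first exact: inv.
exists ((g^-1)%g \o s); first by apply: inv => //; apply: subgroupV.
by apply: funext => i /=; apply: autKV.
Qed.

End InvariantEnd.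

(** If no element carries the half-tree off itself, its translates meet pairwise
    and the group fixes an end. *)
Lemma dense_flips G : is_subgroup G -> geometrically_dense G -> flips G.
Proof.
move=> Ggrp [noend nosub] x y xy; apply: contrapT => no.
have [|xi bxi fixed] := exists_fixed_end Ggrp xy nosub; last exact: noend bxi fixed.
move=> s t Gs Gt; apply: contrapT => disj; apply: no.
exists (s^-1 * t)%g; first by apply: subgroupM => //; apply: subgroupV.
move=> z hz; apply/negP => h; apply: disj; exists (t z); last by rewrite beyond_aut.
by rewrite -(beyond_aut s) !autME autKV in h.
Qed.

End GroupActions.

(** * Transitivity on half-trees and its inheritance by normal subgroups *)

Section Transitivity.
Variables (V : countType) (T : tree V).
Implicit Types (x y z a b u v w : V) (g h t m : aut T) (D G M : set (aut T)).

Local Notation adj := (adj T).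
Local Notation beyond := (beyond T).

(** One of the two half-trees of the second edge misses [x]; applied to that one,
    this shows that two half-trees or their complements are nested or disjoint. *)
Lemma beyond_sub_or_disj x y a b : adj x y -> adj a b -> ~~ beyond a b x ->
  (forall z, beyond a b z -> beyond x y z) \/ (forall z, beyond a b z -> ~~ beyond x y z).
Proof.
move=> xy ab Nx; have yx : adj y x by rewrite adjC.
have [hb|Nb] := boolP (beyond x y b); [left|right] => z.
  exact: beyond_sub.
rewrite -beyondC //; apply: (@beyond_sub _ T y x a b) => //; first by rewrite beyondC.
apply/negP => hy; have [_ yb] := beyond_cross ab xy Nx hy.
by rewrite -yb beyond_tip in Nb.
Qed.

(** When the two half-trees are disjoint, an element that carries the complement
    of the target off itself does the job. The other positions reduce to this one
    by first carrying the source off itself, unless that already suffices or the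
    source lies in the target. *)
Lemma flips_transitive D : is_subgroup D -> flips D -> transitive_on_half_trees D.
Proof.
move=> Dgrp flipD.
have disj x y a b : adj x y -> adj a b -> (forall z, beyond x y z -> ~~ beyond a b z) ->
    exists2 t, D t & forall z, beyond x y z -> beyond a b (t z).
  move=> xy ab dis; have ba : adj b a by rewrite adjC.
  have [t Dt ht] := flipD b a ba; exists t => // z hz.
  by have := ht z; rewrite (beyondC z ab) (beyondC (t z) ab) negbK; apply; apply: dis.
move=> x y a b xy ab; have ba : adj b a by rewrite adjC.
have [t Dt ht] := flipD x y xy.
have [hx|Nx] := boolP (beyond a b x).
  have Nx : ~~ beyond b a x by rewrite beyondC // hx.
  have [sub|dis] := beyond_sub_or_disj xy ba Nx.
    exists t => // z /ht; apply: contraNT => Nz; apply: sub.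
    by rewrite beyondC.
  exists 1%g => [|z]; first exact: subgroup1.
  by apply: contraLR => Nz; apply: dis; rewrite beyondC.
have [sub|dis] := beyond_sub_or_disj xy ab Nx.
  have im : adj (t x) (t y) by rewrite aut_adj.
  have [z|s Ds hs] := disj _ _ _ _ im ab.
    rewrite -{1}(autKV t z) beyond_aut => /ht; rewrite autKV.
    by apply: contraNN => /sub.
  exists (s * t)%g => [|z hz]; first exact: subgroupM.
  by apply: hs; rewrite beyond_aut.
apply: disj => // z hz; apply/negP => /dis; by rewrite hz.
Qed.

(** One element [m] of [M] that carries one half-tree off itself is enough: its
    conjugate by [d] does the same for any half-tree that [d] carries into the
    first one. *)
Lemma transitive_flips D M m u v : transitive_on_half_trees D ->
  (forall d g, D d -> M g -> M (g ^ d)%g) ->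
  adj u v -> M m -> (forall z, beyond u v z -> ~~ beyond u v (m z)) -> flips M.
Proof.
move=> transD normM uv Mm flip x y xy; have [d Dd hd] := transD x y u v xy uv.
exists (m ^ d)%g => [|z hz]; first exact: normM.
by apply: contraNN (flip _ (hd z hz)) => /hd; rewrite !autME autKV.
Qed.

Definition branching v := exists a b c,
  [/\ adj v a, adj v b & adj v c] /\ [/\ a != b, a != c & b != c].

Lemma branching_aut g v : branching v -> branching (g v).
Proof.
move=> [a [b [c [[va vb vc] [ab ac bc]]]]]; exists (g a), (g b), (g c).
by rewrite !aut_adj !(inj_eq (@aut_inj _ _ g)).
Qed.

(** If no vertex has three neighbours, the fixed edge determines the images of the
    neighbouring vertices one after the other. *)
Lemma fixed_edge_branching g x y : g <> 1%g -> adj x y -> g x = x -> g y = y ->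
  exists v, branching v.
Proof.
move=> g1 xy gx gy; apply: contrapT => nobr; apply: g1; apply: autP => z.
suff [] : g z = z /\ exists2 r, adj z r & g r = r by [].
move: z; apply: (@adj_connected _ T _ x); first by split=> //; exists y.
move=> a b ab [ga [r ar gr]].
suff gb : g b = b by split=> //; exists a; rewrite // adjC.
apply: contrapT => /eqP gb; apply: nobr; exists a, b, (g b), r.
have agb : adj a (g b) by rewrite -{1}ga aut_adj.
split=> //; split; first by rewrite eq_sym.
- by apply: contraNneq gb => ->; rewrite gr.
- by apply: contraNneq gb => E; rewrite -[X in _ == X](autVK g) E -{2}gr autVK.
Qed.

(** A half-tree at [v] that points away from [m v] is carried off itself if its
    image points away from [v]. Each of these two conditions fails for at most one
    of the three neighbours of [v]. *)
Lemma branching_flip m v : branching v -> m v != v ->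
  exists a b, adj a b /\ forall z, beyond a b z -> ~~ beyond a b (m z).
Proof.
move=> [a [b [c [[va vb vc] [ab ac bc]]]]] mv.
suff [n vn [Nmv Nv]] : exists2 n, adj v n & ~~ beyond v n (m v) /\ ~~ beyond (m v) (m n) v.
  exists v, n; split=> // z; rewrite -(beyond_aut m); apply: beyond_apart => //.
    by rewrite aut_adj.
  by rewrite eq_sym.
have disj n n' : adj v n -> adj v n' -> n != n' ->
    (beyond v n (m v) -> ~~ beyond v n' (m v)) /\
    (beyond (m v) (m n) v -> ~~ beyond (m v) (m n') v).
  move=> vn vn' nn'; split; apply: beyond_disj; rewrite ?aut_adj //.
  by rewrite (inj_eq (@aut_inj _ _ m)).
apply: contrapT => no.
have bad n : adj v n -> beyond v n (m v) || beyond (m v) (m n) v.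
  move=> vn; apply/negP => /negP; rewrite negb_or => /andP[? ?].
  by apply: no; exists n.
have [Pab Qab] := disj a b va vb ab; have [Pac Qac] := disj a c va vc ac.
have [Pbc Qbc] := disj b c vb vc bc.
case/orP: (bad a va) => [/[dup] /Pab Nb /Pac Nc|/[dup] /Qab Nb /Qac Nc].
- have := bad b vb; rewrite (negPf Nb) /= => /Qbc Nc'.
  by have := bad c vc; rewrite (negPf Nc) (negPf Nc').
- have := bad b vb; rewrite (negPf Nb) orbF => /Pbc Nc'.
  by have := bad c vc; rewrite (negPf Nc) (negPf Nc').
Qed.

(** By [branching_flip], [m] would otherwise fix all the vertices with three
    neighbours. The vertices fixed by every automorphism with this property form
    an invariant subtree, hence are all the vertices. *)
Lemma nontrivial_flip G m v : is_subgroup G ->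
  (forall S, is_subtree T S -> S <> setT -> ~ stabilizes G S) ->
  branching v -> m <> 1%g ->
  exists a b, adj a b /\ forall z, beyond a b z -> ~~ beyond a b (m z).
Proof.
move=> Ggrp minimal br m1; apply: contrapT => no.
have fixbr w : branching w -> m w = w.
  by move=> brw; apply: contrapT => /eqP /(branching_flip brw).
pose S := [set z | forall g, (forall w, branching w -> g w = w) -> g z = z].
suff ST : S = setT.
  apply: m1; apply: autP => z; have Sz : S z by rewrite ST.
  exact: Sz m fixbr.
apply: contrapT => nST; apply: (minimal S) => //.
  apply: geodesically_closed_subtree; first by exists v => g; apply.
  move=> a b a' Sa Sb aa' E g gfix; have ga := Sa g gfix; have gb := Sb g gfix.
  apply: (@closer_uniq _ T b a) => //; first by rewrite -{1}ga aut_adj.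
    by rewrite -{1}gb dist_aut E.
  by rewrite E.
apply: invariant_stabilizes => // g z _ Sz h hfix.
have := Sz (g^-1 * (h * g))%g; rewrite !autME => E.
rewrite -[LHS](autKV g) E // => w brw.
by rewrite !autME hfix ?autVK //; apply: branching_aut.
Qed.

(** Some nontrivial element of [M] carries a half-tree off itself, and conjugation
    by [D] spreads this to all half-trees. The subtrees are those of the larger
    group [G], so that the step can be repeated for subgroups of subgroups. *)
Lemma normalized_transitive_on_half_trees G v D M : is_subgroup G ->
  (forall S, is_subtree T S -> S <> setT -> ~ stabilizes G S) -> branching v ->
  transitive_on_half_trees D -> is_subgroup M -> ~ is_trivial M ->
  (forall d g, D d -> M g -> M (g ^ d)%g) -> transitive_on_half_trees M.
Proof.
move=> Ggrp minimal br transD Mgrp nM normM.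
have [m Mm m1] := exists_nontrivial Mgrp nM.
have [a [b [ab hm]]] := nontrivial_flip Ggrp minimal br m1.
exact: flips_transitive Mgrp (transitive_flips transD normM ab Mm hm).
Qed.

End Transitivity.

(** * Bi-infinite paths and axes *)

Section Lines.
Variables (V : countType) (T : tree V).
Implicit Types (x y z u v w : V) (g h f : aut T) (i j : int).

Local Notation adj := (adj T).
Local Notation dist := (dist T).
Local Notation beyond := (beyond T).
Local Notation branch := (branch T).

(** A geodesic as a sequence of vertices, so that it can be repeated periodically
    along an axis. *)
Lemma geodesic_sequence x y : exists p : nat -> V,
  [/\ p 0%N = x, forall n, (n < dist x y)%N -> adj (p n) (p n.+1)
    & forall n, (n <= dist x y)%N -> dist (p n) y = (dist x y - n)%N].
Proof.
move Dm: (dist x y) => m; elim: m x Dm => [|m IH] x Dm.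
  by exists (fun=> x); split=> // -[].
have [E|/(geodesic_step T)[x' xx' E]] := eqVneq x y.
  by rewrite E dist_refl in Dm.
have [|p [p0 padj pd]] := IH x'; first by lia.
exists (fun n => if n is n'.+1 then p n' else x); split=> //.
  by case=> [|n] lt_n; [rewrite p0 | apply: padj].
by case=> [|n] le_n; rewrite ?Dm // pd.
Qed.

Definition is_biinfinite (c : int -> V) :=
  (forall i, adj (c i) (c (i + 1)%R)) /\ (forall i, c i != c (i + 2)%R).

Section BiinfinitePath.
Variable c : int -> V.
Hypothesis cP : is_biinfinite c.

Lemma beyond_along i j z : (i <= j)%R ->
  beyond (c j) (c (j + 1)%R) z -> beyond (c i) (c (i + 1)%R) z.
Proof.
move=> le_ij; case: cP => cadj cred.
have [n ->] : exists n : nat, j = (i + n%:Z)%R by exists `|(j - i)%R|%N; lia.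
pose d m := c (i + m%:Z)%R.
have dS m : d m.+1 = c (i + m%:Z + 1)%R by congr c; lia.
have dadj m : adj (d m) (d m.+1) by rewrite dS; apply: cadj.
have d0 : d 0%N = c i by congr c; lia.
have d1 : d 1%N = c (i + 1)%R by rewrite dS; congr c; lia.
rewrite -d0 -d1 -dS; apply: (@beyond_nested _ T d dadj _ 0 n).
move=> m; have -> : d m.+2 = c (i + m%:Z + 2)%R by congr c; lia.
exact: cred.
Qed.

Lemma beyond_forward i j : (i < j)%R -> beyond (c i) (c (i + 1)%R) (c j).
Proof.
move=> lt_ij; apply: (@beyond_along _ (j - 1)%R); first by lia.
by have := beyond_tip (cP.1 (j - 1)%R); rewrite subrK.
Qed.

End BiinfinitePath.

Lemma is_biinfinite_opp c : is_biinfinite c -> is_biinfinite (fun i => c (- i)%R).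
Proof.
move=> [cadj cred]; split=> i.
  rewrite adjC; have := cadj (- (i + 1))%R.
  by congr (adj _ (c _)); lia.
rewrite eq_sym; have := cred (- (i + 2))%R.
by congr (_ != c _); lia.
Qed.

Lemma beyond_backward c i j : is_biinfinite c -> (j < i)%R ->
  beyond (c i) (c (i - 1)%R) (c j).
Proof.
move=> /is_biinfinite_opp /beyond_forward cP lt_ji.
have := cP (- i)%R (- j)%R; rewrite !opprK opprD opprK; apply; lia.
Qed.

Lemma is_biinfinite_aut c g : is_biinfinite c -> is_biinfinite (g \o c).
Proof.
move=> [cadj cred]; split=> i /=; first by rewrite aut_adj.
by rewrite (inj_eq (@aut_inj _ _ g)).
Qed.

Lemma is_biinfinite_path c : is_biinfinite c -> is_reduced_path T (c @` setT).
Proof.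
move=> [cadj cred]; exists setT, c; split=> //; first by split; first by exists 0%R.
by move=> i _ _; apply/eqP.
Qed.

Lemma closest_index (c : int -> V) z :
  exists i, forall j, (dist (c i) z <= dist (c j) z)%N.
Proof.
pose P n := `[< exists i, dist (c i) z = n >].
have exP : exists n, P n by exists (dist (c 0%R) z); apply/asboolP; exists 0%R.
case: (ex_minnP exP) => _ /asboolP[i <-] le; exists i => j.
by apply: le; apply/asboolP; exists j.
Qed.

(** If [z] were closest to two vertices of the path, it would not lie beyond the
    first step from one towards the other, although its distance drops at the
    last step. *)
Lemma branches_disjoint c i j z : is_biinfinite c ->
  branch (c @` setT) (c i) z -> branch (c @` setT) (c j) z -> i = j.
Proof.
move=> cP; wlog lt_ij : i j / (i < j)%R.
  move=> W bi bj; have [ltij|ltji|//] := ltgtP i j; first exact: W.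
  by apply/esym; apply: W.
move=> bi bj; have inC l : (c @` setT) (c l) by exists l.
have adji := cP.1 i; have := cP.1 (j - 1)%R; rewrite subrK => adjj.
have lei := bi _ (inC (i + 1)%R); have lej := bj _ (inC (j - 1)%R).
suff : beyond (c i) (c (i + 1)%R) z by rewrite beyondE ltnNge lei.
apply: (@beyond_along _ cP _ (j - 1)%R); first by lia.
by move: lej (dist_adjE z adjj); rewrite subrK beyondE; lia.
Qed.

Lemma branch_aut c g z l : (forall i, c (i + l)%R = g (c i)) ->
  forall i, branch (c @` setT) (c i) z -> branch (c @` setT) (c (i + l)%R) (g z).
Proof.
move=> cl i bi _ [j _ <-].
have -> : c j = g (c (j - l)%R) by rewrite -cl subrK.
by rewrite cl !dist_aut; apply: bi; exists (j - l)%R.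
Qed.

Lemma biinfinite_inj c : is_biinfinite c -> injective c.
Proof.
move=> cP i j E; have bi : branch (c @` setT) (c i) (c i).
  by move=> v _; rewrite dist_refl.
by apply: (branches_disjoint cP bi); rewrite E in bi *.
Qed.

(** Powers with an integer exponent, for the translates of a fundamental segment
    in both directions of the axis. *)
Definition zpow g i := match i with Posz n => g ^+ n | Negz n => g^-1 ^+ n.+1 end%g.

Lemma zpowS g i : zpow g (i + 1)%R = (g * zpow g i)%g.
Proof.
case: i => [n|[|n]].
- by rewrite -PoszD addn1 /= expgS.
- by rewrite /= expg1 mulgV.
- have -> : (Negz n.+1 + 1)%R = Negz n by lia.
  by rewrite /= [in RHS]expgS mulVKg.
Qed.

Lemma zpowC g i : (zpow g i * g)%g = (g * zpow g i)%g.
Proof.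
apply: commute_sym; have gg := @commute_refl _ g.
by case: i => n; apply: commuteX => //; apply: commuteV.
Qed.

(** The geodesic from [u] to [h v] runs along the edge from [u] to [v] at its
    start and along the edge from [h u] to [h v] at its end, so its translates
    under the powers of [h] fit together without backtracking. *)
Lemma hyperbolic_axis h u v : adj u v -> beyond u v (h u) -> ~~ beyond (h u) (h v) u ->
  exists c l, [/\ (0 < l)%N, is_biinfinite c, forall i, c (i + l%:Z)%R = h (c i),
                  c 0%R = u & c 1%R = v].
Proof.
move=> uv hu Nu; have huv : adj (h u) (h v) by rewrite aut_adj.
have [p [p0 padj pd]] := geodesic_sequence u (h v).
have uhv : dist u (h v) = (dist u (h u)).+1.
  by have := dist_adjE u huv; rewrite beyondE !(distC T _ u) in Nu *; lia.
set l := dist u (h u) in uhv.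
have l0 : (0 < l)%N.
  rewrite lt0n; apply/negP => /eqP /dist_eq0 E.
  by rewrite -E beyond_base in hu.
rewrite uhv in padj pd.
have p1 : p 1%N = v.
  apply: (@closer_uniq _ T (h v) u) => //; first by rewrite -{1}p0; apply: padj.
    by rewrite pd // uhv; lia.
  apply: contraTT Nu => Nhv; rewrite negbK.
  have [] := beyond_cross uv _ Nhv hu; first by rewrite adjC.
  by move=> -> ->; rewrite beyond_tip // adjC.
have dup n : (n <= l.+1)%N -> (dist u (p n) <= n)%N.
  elim: n => [|n IH] lt_n; first by rewrite p0 dist_refl.
  have := IH (ltnW lt_n); have := padj n lt_n; rewrite adjC => /(dist_adj u).
  by rewrite !(distC T u); lia.
have pl1 : p l.+1 = h v by apply: (@dist_eq0 _ T); rewrite pd // subnn.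
have pl : p l = h u.
  apply: (@closer_uniq _ T u (h v)); rewrite 1?adjC //.
  - by rewrite -pl1; apply: padj.
  - by rewrite -!(distC T u) uhv ltnS dup.
  - by rewrite -!(distC T u) uhv.
pose c i := zpow h (divz i l%:Z) (p `|modz i l%:Z|%N).
have l0z : (l%:Z != 0)%R by lia.
(* The formula for [c] persists up to [r = l + 1] because [p] ends with the
   image of its first edge; this covers two steps from each vertex. *)
have cE (q : int) r : (r <= l.+1)%N -> c (q * l%:Z + r%:Z)%R = zpow h q (p r).
  have small r' q' : (r' < l)%N -> c (q' * l%:Z + r'%:Z)%R = zpow h q' (p r').
    move=> lt_r; have r_small : (0 <= r'%:Z < `|l%:Z|)%R by lia.
    by rewrite /c divzMDl // modzMDl divz_small // modz_small // addr0.
  have le_l r' q' : (r' <= l)%N -> c (q' * l%:Z + r'%:Z)%R = zpow h q' (p r').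
    rewrite leq_eqVlt => /predU1P[->|]; last exact: small.
    rewrite pl -autME zpowC -zpowS -p0 -small //; congr c.
    by rewrite mulrDl mul1r addr0.
  rewrite leq_eqVlt => /predU1P[->|]; last exact: le_l.
  rewrite pl1 -autME zpowC -zpowS -p1 -le_l //; congr c.
  by rewrite mulrDl mul1r; lia.
have split_int i : exists (q : int) r, (r < l)%N /\ i = (q * l%:Z + r%:Z)%R.
  exists (divz i l%:Z), `|modz i l%:Z|%N.
  have := divz_eq i l%:Z; have := modz_ge0 i l0z.
  by have := ltz_pmod i (_ : 0 < l%:Z)%R; lia.
exists c, l; split=> //.
- split=> i; have [q [r [lt_r ->]]] := split_int i.
    have -> : (q * l%:Z + r%:Z + 1 = q * l%:Z + r.+1%:Z)%R by lia.
    rewrite !cE; try lia.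
    by rewrite aut_adj; apply: padj; lia.
  have -> : (q * l%:Z + r%:Z + 2 = q * l%:Z + r.+2%:Z)%R by lia.
  rewrite !cE; try lia.
  rewrite (inj_eq (@aut_inj _ _ _)); apply/eqP => E.
  by have := pd r (leqW (ltnW lt_r)); rewrite E pd //; lia.
- move=> i; have [q [r [lt_r ->]]] := split_int i.
  have -> : (q * l%:Z + r%:Z + l%:Z = (q + 1) * l%:Z + r%:Z)%R by rewrite mulrDl mul1r; lia.
  by rewrite !cE ?zpowS //; lia.
- by have := cE 0%R 0%N; rewrite mul0r add0r /= => ->.
- by have := cE 0%R 1%N; rewrite mul0r add0r /= => ->.
Qed.

End Lines.

(** * Fixators, branches and Property P_k *)

Section FixAndBranches.
Variables (V : countType) (T : tree V).
Implicit Types (x y z u v w : V) (g h f : aut T) (i j : int) (G D : set (aut T)).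
Implicit Types (C Y : set V).

Local Notation adj := (adj T).
Local Notation beyond := (beyond T).
Local Notation branch := (branch T).
Local Notation nbhd := (nbhd T).

Lemma Fix_subgroup G Y : is_subgroup G -> is_subgroup (Fix G Y).
Proof.
move=> Ggrp; apply: is_subgroupI; first by split=> //; apply: subgroup1.
move=> g h [Gg gY] [Gh hY]; split; first by apply: subgroupM => //; apply: subgroupV.
by move=> y Yy; rewrite autME -{1}(hY y Yy) autVK gY.
Qed.

Lemma Fix_conj G Y g h : is_subgroup G -> G h -> (forall y, Y y -> Y (h y)) ->
  Fix G Y g -> Fix G Y (g ^ h)%g.
Proof.
move=> Ggrp Gh hY [Gg gY]; split.
  by rewrite conjgE; do 2?apply: subgroupM => //; apply: subgroupV.
by move=> y Yy; rewrite !autME gY ?autVK //; apply: hY.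
Qed.

Lemma Fix_anti G Y Y' : Y `<=` Y' -> Fix G Y' `<=` Fix G Y.
Proof. by move=> sub g [Gg gY']; split=> // y /sub; apply: gY'. Qed.

Lemma sub_nbhd C m : C `<=` nbhd C m.
Proof. by move=> x Cx; exists x; rewrite // dist_refl. Qed.

Lemma nbhdS C C' m : C `<=` C' -> nbhd C m `<=` nbhd C' m.
Proof. by move=> sub y [x /sub C'x d]; exists x. Qed.

Lemma nbhd_aut g C m : (forall x, C x -> C (g x)) ->
  forall y, nbhd C m y -> nbhd C m (g y).
Proof. by move=> gC y [x Cx d]; exists (g x); rewrite ?dist_aut //; apply: gC. Qed.

Lemma branch_fix C x g z : C x -> (forall y, C y -> g y = y) ->
  branch C x z -> branch C x (g z).
Proof.
by move=> Cx gC bz y Cy; rewrite -{1}(gC x Cx) -{1}(gC y Cy) !dist_aut; apply: bz.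
Qed.

(** Property [P_k] in the form in which it is used: one may prescribe the
    restrictions of an element of the fixator to the branches independently. *)
Lemma property_P_glue k G C (s : V -> aut T) : property_P k G -> is_reduced_path T C ->
  (forall v, C v -> Fix G (nbhd C k.-1) (s v)) ->
  exists2 f, Fix G (nbhd C k.-1) f &
    forall v z, C v -> branch C v z -> f z = s v z.
Proof.
move=> PG /PG [_ [_ _ surj]] sC.
pose phi (v : C) := restr C (\val v) (s (\val v)).
have [v|f Ff Ef] := surj phi; first by exists (s (\val v)) => //; apply/sC/set_valP.
exists f => // v z Cv bz; pose v' : C := exist _ v (mem_set Cv).
have /(congr1 (fun F => F v' z)) := Ef.
by rewrite /phi /Phi /restr /patch /= mem_set.
Qed.

Lemma edge_reduced_path x y : adj x y -> is_reduced_path T [set x; y].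
Proof.
move=> xy; exists [set 0%R; 1%R], (fun i => if i == 0%R then x else y).
split.
- split; first by exists 0%R; left.
  by move=> i j l [->|->] [->|->] /=; lia.
- by move=> i [->|->] [] //=; lia.
- by move=> i [->|->] [] /=; lia.
- apply/seteqP; split=> z /=; first by case=> ->; [exists 0%R; first left|exists 1%R; first right].
  by case=> i [->|->] <- /=; [left|right].
Qed.

Lemma edge_branch x y z : adj x y -> ~~ beyond x y z -> branch [set x; y] x z.
Proof. by move=> xy Nz v [->|->] //; move: Nz; rewrite beyondE -leqNgt. Qed.

(** The branches of a single edge are its two half-trees; [g] is the factor of [t]
    that acts on the side of [x]. *)
Lemma Fix_edge_split k G x y t : is_subgroup G -> property_P k G -> adj x y ->
  Fix G (nbhd [set x; y] k.-1) t ->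
  exists2 g, Fix G (nbhd [set x; y] k.-1) g &
    (forall z, beyond x y z -> g z = z) /\ (forall z, beyond y x z -> g z = t z).
Proof.
move=> Ggrp PG xy Ft; have yx : adj y x by rewrite adjC.
have Fgrp := Fix_subgroup (nbhd [set x; y] k.-1) Ggrp.
pose s v := if v == x then t else 1%g.
have [|v _|g Fg gE] := @property_P_glue k G [set x; y] s PG.
- exact: edge_reduced_path.
- by rewrite /s; case: ifP => _ //; apply: (subgroup1 Fgrp).
exists g => //; split=> z; rewrite beyondC // => Nz.
  rewrite (gE y) /s; [|by right|]; first by rewrite eq_sym (negPf (adj_neq xy)).
  by rewrite setUC; apply: edge_branch.
by rewrite (gE x) /s ?eqxx //; [left|apply: edge_branch].
Qed.

End FixAndBranches.

(** * The commutator trick *)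

Section Commutator.
Variables (V : countType) (T : tree V) (k : nat) (G : set (aut T)).
Hypotheses (Ggrp : is_subgroup G) (PG : property_P k G).
Implicit Types (x y z u v w : V) (g h f : aut T) (i j : int).

Local Notation adj := (adj T).
Local Notation dist := (dist T).
Local Notation beyond := (beyond T).
Local Notation branch := (branch T).
Local Notation nbhd := (nbhd T).

(** What the neighbourhood of the path contains outside the half-tree is already
    close to [x]; hence an element that is trivial on the half-tree and near the
    edge fixes the whole neighbourhood of the path. *)
Lemma nbhd_beyond c x y : adj x y -> (forall i : int, beyond x y (c i)) ->
  forall m z, nbhd (c @` setT) m z -> beyond x y z \/ nbhd [set x; y] m z.
Proof.
move=> xy cxy m z [_ [i _ <-] d]; have [|Nz] := boolP (beyond x y z); first by left.
right; exists x; first by left.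
by move: d; rewrite (dist_through xy (cxy i) Nz); lia.
Qed.

(** All of the complement of the half-tree hangs at the vertex of the path that is
    closest to [x], since every path to the complement goes through [x]. *)
Lemma beyond_branch c x y i : adj x y -> (forall i : int, beyond x y (c i)) ->
  (forall j, dist (c i) x <= dist (c j) x)%N ->
  forall z, ~~ beyond x y z -> branch (c @` setT) (c i) z.
Proof.
move=> xy cxy le z Nz _ [j _ <-].
by rewrite !(dist_through xy (cxy _) Nz) leq_add2r.
Qed.

(** On the branch at the vertex of index [i], the element [f] acts as [K i], where
    [K] is [g] at the vertex [c i0] from which the support of [g] hangs, its
    conjugates by the powers of [h] at the translates of that vertex in the
    positive direction, and trivial elsewhere. The family is thus shifted by [h],
    except that the shifted one starts one step later. *)
Lemma commutator_trick x y c l g h : adj x y -> G h -> (0 < l)%N ->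
  is_biinfinite T c -> (forall i, c (i + l%:Z)%R = h (c i)) ->
  (forall i, beyond x y (c i)) ->
  Fix G (nbhd [set x; y] k.-1) g -> (forall z, beyond x y z -> g z = z) ->
  exists2 f, Fix G (nbhd (c @` setT) k.-1) f & g = (f * (h * f^-1 * h^-1))%g.
Proof.
move=> xy Gh l0 cP cl cxy [Gg gfix] gid.
pose C := c @` [set: int]; have inC i : C (c i) by exists i.
have cinj := biinfinite_inj cP.
have Fgrp := Fix_subgroup (nbhd C k.-1) Ggrp.
have clV i : c (i - l%:Z)%R = (h^-1)%g (c i).
  by rewrite -[i in RHS](subrK l%:Z%R) cl autVK.
have FgC : Fix G (nbhd C k.-1) g.
  by split=> // z /(nbhd_beyond xy cxy) [|]; [apply: gid|apply: gfix].
have [i0 i0P] := closest_index T c x.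
have gbranch i z : i != i0 -> branch C (c i) z -> g z = z.
  move=> ni bz; apply: gid; apply: contraNT ni => Nz; apply/eqP.
  exact: branches_disjoint bz (beyond_branch xy cxy i0P Nz).
pose K i := if (i0 <= i)%R && (l %| absz (i - i0)%R)%N
  then (g ^ ((h^-1) ^+ (absz (i - i0)%R %/ l)))%g else 1%g.
have K0 : K i0 = g by rewrite /K lexx subrr dvdn0 div0n expg0 conjg1.
have K0l : K (i0 - l%:Z)%R = 1%g by rewrite /K ifF //; apply/negbTE; lia.
(* Conjugation by [h] shifts the family, except at [i0]. *)
have KS i : i != i0 -> K i = (K (i - l%:Z)%R ^ h^-1)%g.
  move=> ni; rewrite /K; have [le|gt] := leP i0 (i - l%:Z)%R.
    have -> : absz (i - i0)%R = (absz (i - l%:Z - i0)%R + l)%N by lia.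
    rewrite dvdn_addl // divnDr // divnn l0 addn1 expgSr conjgM.
    have -> : (i0 <= i)%R by lia.
    by case: ifP; rewrite ?conj1g.
  rewrite /= conj1g; case: ifP => // /andP[le dvd]; exfalso.
  have : (l <= absz (i - i0)%R)%N by apply: dvdn_leq => //; lia.
  lia.
have hC v : C v -> C ((h^-1)%g v).
  by move=> [i _ <-]; rewrite -clV.
have FK i : Fix G (nbhd C k.-1) (K i).
  rewrite /K; case: ifP => _; last exact: (subgroup1 Fgrp).
  elim: (_ %/ _)%N => [|n IH]; first by rewrite expg0 conjg1.
  rewrite expgSr conjgM; apply: Fix_conj => //; first exact: subgroupV.
  exact: nbhd_aut.
have idx v : exists i, C v -> v = c i.
  by have [[i _ <-]|nC] := pselect (C v); [exists i|exists 0%R].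
have [ix ixP] := choice idx.
have ixK i : ix (c i) = i by apply/esym/cinj/ixP.
have [|v Cv|f Ff fE] := @property_P_glue _ T k G C (K \o ix) PG.
- exact: is_biinfinite_path.
- exact: FK.
exists f => //; suff E : (g * (h * (f * h^-1)) = f)%g.
  by rewrite -[LHS](mulgK (h * (f * h^-1))%g) E !invgM invgK.
apply: autP => z; rewrite !autME.
have [i iP] := closest_index T c z.
have bz : branch C (c i) z by move=> _ [j _ <-].
have bhz : branch C (c (i - l%:Z)%R) ((h^-1)%g z).
  by apply: branch_aut bz => j; apply: clV.
rewrite (fE _ _ (inC _) bhz) (fE _ _ (inC _) bz) /= !ixK.
have [->|ni] := eqVneq i i0; first by rewrite K0l K0 /= autKV.
rewrite (KS i ni) conjgE invgK !autME.
apply: (gbranch i) => //; rewrite -[h _]/((h * (K (i - l%:Z)%R * h^-1))%g z).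
have -> : (h * (K (i - l%:Z)%R * h^-1))%g = K i by rewrite (KS i ni) conjgE invgK.
apply: branch_fix => // v Cv; apply: (FK i).2; exact: sub_nbhd.
Qed.

End Commutator.

(** * Hyperbolic elements with axis in a half-tree *)

Section Density.
Variables (V : countType) (T : tree V).
Implicit Types (x y z u v w : V) (N : set (aut T)).

Local Notation adj := (adj T).
Local Notation beyond := (beyond T).

(** Let [v] have neighbours [a], [b], [w]. An element that carries the half-tree
    from [b] through [v] into the one beyond [w] has an axis through [b], [v]
    and [w], which therefore avoids [a]. It remains to carry the half-tree from [a]
    through [v] into the given one. *)
Lemma axis_in_half N v x y : is_subgroup N -> transitive_on_half_trees N -> branching T v ->
  adj x y -> exists h c l, [/\ N h, (0 < l)%N, is_biinfinite T c,
    forall i, c (i + l%:Z)%R = h (c i) & forall i : int, beyond x y (c i)].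
Proof.
move=> Ngrp transN [a [b [w [[va vb vw] [ab aw bw]]]]] xy.
have bv : adj b v by rewrite adjC.
have av : adj a v by rewrite adjC.
have [h Nh hbw] := transN b v v w bv vw.
have hv : beyond v w (h v) by apply/hbw/beyond_tip.
have adjh : adj (h b) (h v) by rewrite aut_adj.
have hb : beyond b v (h b).
  have [/beyond_next|Nw] := boolP (beyond v w (h b)); first exact.
  by have [-> _] := beyond_cross vw adjh Nw hv; apply: beyond_tip.
have Nb : ~~ beyond (h b) (h v) b.
  apply/negP; rewrite -{2}(autKV h b) beyond_aut => /hbw; rewrite autKV => h1.
  by have := beyond_disj vw vb _ h1; rewrite eq_sym bw beyond_tip // => /(_ isT).
have [c [l [l0 cP cl c0 c1]]] := hyperbolic_axis bv hb Nb.
have c2 : c 2%R = w.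
  have adj2 : adj v (c 2%R) by rewrite -c1; apply: cP.1.
  apply: (closer_uniq adj2 vw _ hv).
  have := @beyond_forward _ _ c cP 1%R (1 + l%:Z)%R; rewrite cl c1; apply; lia.
have c_av i : beyond a v (c i).
  have [->|] := eqVneq i 1%R; first by rewrite c1 beyond_tip.
  rewrite neq_lt => /orP[lt_i1|lt_1i].
    have := beyond_backward cP lt_i1; rewrite c1 subrr c0.
    by apply: beyond_next.
  have := beyond_forward cP lt_1i; rewrite c1 [(1 + 1)%R]/(2%R) c2.
  by apply: beyond_next.
have [d Nd dP] := transN a v x y av xy.
exists (h ^ d^-1)%g, (d \o c), l; split=> //.
- rewrite conjgE invgK; apply: (subgroupM Ngrp) => //.
  by apply: (subgroupM Ngrp) => //; apply: subgroupV.
- exact: is_biinfinite_aut.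
- by move=> i; rewrite conjgE invgK !autME [(d \o c) i]/comp autVK /= cl.
- by move=> i; apply: dP.
Qed.

Lemma generators_conj k (G : set (aut T)) g d : is_subgroup G -> G d ->
  (exists x y, adj x y /\ Fix G (nbhd T [set x; y] k.-1) g) ->
  (exists x y, adj x y /\ Fix G (nbhd T [set x; y] k.-1) (g ^ d)%g).
Proof.
move=> Ggrp Gd [x [y [xy [Gg gfix]]]]; exists (d^-1 x)%g, (d^-1 y)%g.
split; first by rewrite aut_adj.
split.
  by rewrite conjgE; do 2?apply: subgroupM => //; apply: subgroupV.
move=> z [w xyw dz]; rewrite conjgE !autME gfix ?autVK //.
exists (d w); rewrite ?dist_aut //.
by case: xyw => ->; rewrite autKV; [left|right].
Qed.

End Density.

(** * Simplicity *)

Theorem theorem3p3 (V : countType) (T : tree V) (k : nat) (G : set (aut T)) :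
  ~ is_line T ->
  (1 <= k)%N ->
  is_subgroup G ->
  geometrically_dense G ->
  property_P k G ->
  is_simple (G_plus k G) \/ is_trivial (G_plus k G).
Proof.
move=> _ _ Ggrp dense PG; set H := G_plus k G.
have minimal := dense.2.
have Hgrp : is_subgroup H := generated_subgroup _.
have [triv|ntriv] := pselect (is_trivial H); [by right|left; split=> // N].
move=> [Ngrp NH normN]; have [Ntriv|nN] := pselect (is_trivial N); [by left|right].
have HG g : H g -> G g.
  apply: (@smallest_sub _ _ _ G) => // t [x [y [_ [Gt _]]]]; exact: Gt.
(* A nontrivial generator of [H] fixes an edge. *)
have [v br] : exists v, branching T v.
  apply: contrapT => nobr; apply: ntriv; apply/seteqP; split=> g; last first.
    by move=> ->; apply: subgroup1.
  apply: (@smallest_sub _ _ _ [set 1%g]) => [|t [x [y [xy Ft]]]].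
    by apply: is_subgroupI => // a b -> ->; rewrite mulgV.
  apply: contrapT => t1; apply: nobr; apply: (fixed_edge_branching t1 xy).
    by apply: Ft.2; apply: sub_nbhd; left.
  by apply: Ft.2; apply: sub_nbhd; right.
have transG := flips_transitive Ggrp (dense_flips Ggrp dense).
have normH d g : G d -> H g -> H (g ^ d)%g.
  by move=> Gd; apply: generated_conj => t; apply: generators_conj.
(* Density passes from [G] to [H], and from [H] to [N]. *)
have transH := normalized_transitive_on_half_trees Ggrp minimal br transG Hgrp ntriv normH.
have normHN h n : H h -> N n -> N (n ^ h)%g by move=> Hh Nn; apply: normN.
have transN := normalized_transitive_on_half_trees Ggrp minimal br transH Ngrp nN normHN.
have half_fixators x y g : adj T x y -> Fix G (nbhd T [set x; y] k.-1) g ->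
    (forall z, beyond T x y z -> g z = z) -> N g.
  move=> xy Fg gid.
  have [h [c [l [Nh l0 cP cl cxy]]]] := axis_in_half Ngrp transN br xy.
  have [f Ff ->] := commutator_trick Ggrp PG xy (HG h (NH h Nh)) l0 cP cl cxy Fg gid.
  (* [f] fixes the neighbourhood of every edge of the axis. *)
  have Hf : H f.
    apply: (@sub_gen_smallest _ _ [set g | _]); exists (c 0%R), (c 1%R).
    split; first exact: cP.1 0%R.
    by apply: Fix_anti Ff; apply: nbhdS => z [->|->]; [exists 0%R|exists 1%R].
  have -> : (f * (h * f^-1 * h^-1) = h ^ f^-1 * h^-1)%g by rewrite conjgE invgK !mulgA.
  apply: (subgroupM Ngrp); last exact: (subgroupV Ngrp).
  by apply: normHN => //; apply: (subgroupV Hgrp).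
apply/seteqP; split=> //; apply: smallest_sub => // t [x [y [xy Ft]]].
have [g Fg [gid gt]] := Fix_edge_split Ggrp PG xy Ft.
have Fgrp := Fix_subgroup (nbhd T [set x; y] k.-1) Ggrp.
have yx : adj T y x by rewrite adjC.
rewrite -[t](mulVKg g); apply: (subgroupM Ngrp); first exact: half_fixators Fg gid.
apply: (half_fixators y x) => // [|z hz].
  by rewrite setUC; apply: (subgroupM Fgrp) => //; apply: (subgroupV Fgrp).
by rewrite autME -gt // autVK.
Qed.
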